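(* Let $s,t,p\ge 1$, $A,B\in GL(n)$ and $Q\in\mathcal{P}(n)$ with $k=\lambda_1(Q)>1$. Put $\tilde k=\lambda_n(Q)$, $q=\min\{t/s,p/s\}$ and $\tilde q=\max\{t/s,p/s\}$. If $$\|A\|^2+\|B\|^2<\frac{q^{\tilde q}\,\tilde k^{\tilde q+1}}{k^{\tilde q}(q+1)^{\tilde q+1}},$$ then the equation $X^s+A^*X^{-t}A+B^*X^{-p}B=Q$ has a Hermitian positive definite solution in $\big[\big(\tfrac{q\tilde k}{k(q+1)}\big)^{1/s}I,\;Q^{1/s}\big]$.
   Context: $GL(n)$: $n\times n$ complex nonsingular matrices; $\mathcal{P}(n)$: $n\times n$ Hermitian positive definite matrices. For Hermitian $M$, $\lambda_1(M)$ and $\lambda_n(M)$ are its largest and smallest eigenvalues. $\|\cdot\|$ is the spectral norm. For Hermitian $P,R$, $P\le R$ means $R-P$ is positive semidefinite, and $[P,R]=\{X \text{ Hermitian}: P\le X\le R\}$. Real powers of positive definite matrices are defined by functional calculus. *)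

(* Defs.v *)
From Stdlib Require Import Reals ClassicalEpsilon.
Open Scope R_scope.

Record C := mkC { re : R; im : R }.
Definition C0 : C := mkC 0 0.
Definition C1 : C := mkC 1 0.
Definition RtoC (x : R) : C := mkC x 0.
Definition Cadd (a b : C) : C := mkC (re a + re b) (im a + im b).
Definition Cmul (a b : C) : C :=
  mkC (re a * re b - im a * im b) (re a * im b + im a * re b).
Definition Cconj (a : C) : C := mkC (re a) (- im a).

(** n x n complex matrices, as functions on indices; only indices < n matter. *)
Definition Mat := nat -> nat -> C.
Definition Vec := nat -> C.

Fixpoint csum (f : nat -> C) (n : nat) : C :=
  match n with O => C0 | S m => Cadd (csum f m) (f m) end.

Definition mmul (n : nat) (A B : Mat) : Mat :=
  fun i j => csum (fun k => Cmul (A i k) (B k j)) n.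
Definition madd (A B : Mat) : Mat := fun i j => Cadd (A i j) (B i j).
Definition madj (A : Mat) : Mat := fun i j => Cconj (A j i).
Definition mscal (c : R) : Mat := fun i j => if Nat.eqb i j then RtoC c else C0.
Definition mid : Mat := mscal 1.
Definition mzero : Mat := fun _ _ => C0.
Definition mdiag (d : nat -> R) : Mat :=
  fun i j => if Nat.eqb i j then RtoC (d i) else C0.
Definition msub (A B : Mat) : Mat :=
  fun i j => Cadd (A i j) (Cmul (RtoC (-1)) (B i j)).

Definition mvmul (n : nat) (A : Mat) (v : Vec) : Vec :=
  fun i => csum (fun k => Cmul (A i k) (v k)) n.
Definition inner (n : nat) (u v : Vec) : C :=
  csum (fun i => Cmul (Cconj (u i)) (v i)) n.
Definition vnorm2 (n : nat) (v : Vec) : R := re (inner n v v).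

Definition meq (n : nat) (A B : Mat) : Prop :=
  forall i j, (i < n)%nat -> (j < n)%nat -> A i j = B i j.
Definition veq (n : nat) (u v : Vec) : Prop :=
  forall i, (i < n)%nat -> u i = v i.
Definition vnonzero (n : nat) (v : Vec) : Prop :=
  exists i, (i < n)%nat /\ v i <> C0.

Definition GL (n : nat) (A : Mat) : Prop :=
  exists Ai, meq n (mmul n A Ai) mid /\ meq n (mmul n Ai A) mid.

Definition Hermitian (n : nat) (M : Mat) : Prop := meq n (madj M) M.
Definition PSD (n : nat) (M : Mat) : Prop :=
  Hermitian n M /\ forall v, 0 <= re (inner n v (mvmul n M v)).
Definition PD (n : nat) (M : Mat) : Prop :=
  Hermitian n M /\ forall v, vnonzero n v -> 0 < re (inner n v (mvmul n M v)).
Definition Lle (n : nat) (P Q : Mat) : Prop := PSD n (msub Q P).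

Definition Unitary (n : nat) (U : Mat) : Prop := meq n (mmul n (madj U) U) mid.

Definition PowRel (n : nat) (X : Mat) (r : R) (Y : Mat) : Prop :=
  exists U d, Unitary n U /\ (forall i, (i < n)%nat -> 0 < d i) /\
    meq n X (mmul n (mmul n U (mdiag d)) (madj U)) /\
    meq n Y (mmul n (mmul n U (mdiag (fun i => Rpower (d i) r))) (madj U)).
Definition mpow (n : nat) (X : Mat) (r : R) : Mat :=
  epsilon (inhabits mzero) (fun Y => PowRel n X r Y).

Definition eigval (n : nat) (M : Mat) (mu : R) : Prop :=
  exists v, vnonzero n v /\ veq n (mvmul n M v) (fun i => Cmul (RtoC mu) (v i)).
Definition is_lmax (n : nat) (M : Mat) (k : R) : Prop :=
  eigval n M k /\ forall mu, eigval n M mu -> mu <= k.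
Definition is_lmin (n : nat) (M : Mat) (k : R) : Prop :=
  eigval n M k /\ forall mu, eigval n M mu -> k <= mu.

Definition is_opnorm (n : nat) (A : Mat) (a : R) : Prop :=
  is_lub (fun x => exists v, vnorm2 n v = 1 /\ x = sqrt (vnorm2 n (mvmul n A v))) a.

(* Main.v *)
(** With [Y = X^s] the equation reads [Y + A^* Y^(-t/s) A + B^* Y^(-p/s) B = Q].
    Let [a = q kt / (k (q + 1))]. The norm condition gives
    [a + |A|^2 a^(-t/s) + |B|^2 a^(-p/s) < kt], and by continuity some [b > a] turns
    this into an equality. By convexity, the slopes of the chords over [a, b] are
    Lipschitz constants on [b, oo) of the two negative powers, and subtracting the
    relations at [a] and [b] shows that these constants, weighted by [|A|^2] and
    [|B|^2], add up to less than [1]. For the Frobenius norm a function of Hermitian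
    matrices is as Lipschitz as the underlying scalar function, so
    [Y |-> Q - A^* Y^(-t/s) A - B^* Y^(-p/s) B] is a contraction; its fixed point
    satisfies [b I <= Y <= Q]. The Loewner-Heinz inequality for the exponent [1 / s]
    then bounds [X = Y^(1/s)] by [Q^(1/s)]. *)

From HB Require Import structures.
Require Import Defs.
From Stdlib Require Import Reals ClassicalEpsilon.
From mathcomp Require Import all_boot all_order all_algebra.
From mathcomp Require Import complex Rstruct ring lra.
Set Implicit Arguments.
Unset Strict Implicit.
Unset Printing Implicit Defensive.
Import Order.TTheory GRing.Theory Num.Theory.
Local Open Scope ring_scope.
Local Open Scope sesquilinear_scope.

(** * Frobenius inner product and norm *)

HB.lock Definition rdot (R : rcfType) (m n : nat) (M N : 'M[R[i]]_(m, n)) : R :=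
  complex.Re (\tr (M ^t* *m N)).

Section RealInnerProduct.
Variable R : rcfType.
Local Notation C := R[i].

Definition normc2 (z : C) : R := complex.Re z ^+ 2 + complex.Im z ^+ 2.

Lemma normc2_ge0 z : 0 <= normc2 z.
Proof. by rewrite addr_ge0 ?sqr_ge0. Qed.

Lemma normc2_eq0 z : (normc2 z == 0) = (z == 0).
Proof. by case: z => a b; rewrite eq_complex paddr_eq0 ?sqr_ge0 // !sqrf_eq0. Qed.

Lemma normc2Z (z : C) (c : R) : normc2 (z * c%:C%C) = normc2 z * c ^+ 2.
Proof. by case: z => a b; rewrite /normc2 /=; ring. Qed.

Lemma trmxC_mul (m n k : nat) (A : 'M[C]_(m, n)) (B : 'M[C]_(n, k)) :
  (A *m B) ^t* = B ^t* *m A ^t*.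
Proof. by rewrite trmx_mul map_mxM. Qed.

Lemma trmxCD (m n : nat) (A B : 'M[C]_(m, n)) : (A + B) ^t* = A ^t* + B ^t*.
Proof. by rewrite linearD /= map_mxD. Qed.

Lemma trmxCB (m n : nat) (A B : 'M[C]_(m, n)) : (A - B) ^t* = A ^t* - B ^t*.
Proof. by rewrite linearB /= map_mxB. Qed.

Lemma trmxCZ (m n : nat) (c : R) (A : 'M[C]_(m, n)) :
  (c%:C%C *: A) ^t* = c%:C%C *: A ^t*.
Proof. by rewrite linearZ /= map_mxZ; congr (_ *: _); apply: conjc_real. Qed.

Section FixedShape.
Variables m n : nat.
Implicit Types (c : R) (L M N : 'M[C]_(m, n)).

Lemma rdotE M N : rdot M N = \sum_i \sum_j
  (complex.Re (M i j) * complex.Re (N i j) + complex.Im (M i j) * complex.Im (N i j)).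
Proof.
rewrite rdot.unlock /mxtrace exchange_big /= raddf_sum; apply: eq_bigr => j _.
rewrite !mxE raddf_sum; apply: eq_bigr => i _; rewrite !mxE.
by case: (M i j) (N i j) => [a b] [c d] /=; ring.
Qed.

Lemma rdotC M N : rdot M N = rdot N M.
Proof.
rewrite !rdotE; apply: eq_bigr => i _; apply: eq_bigr => j _.
by rewrite mulrC [X in _ + X]mulrC.
Qed.

Lemma rdotDr L M N : rdot L (M + N) = rdot L M + rdot L N.
Proof. by rewrite rdot.unlock mulmxDr !raddfD. Qed.

Lemma rdotZr c M N : rdot M (c%:C%C *: N) = c * rdot M N.
Proof.
rewrite rdot.unlock -scalemxAr linearZ /=; case: (\tr _) => a b /=; ring.
Qed.

Lemma rdotNr M N : rdot M (- N) = - rdot M N.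
Proof. by rewrite rdot.unlock mulmxN !raddfN. Qed.

Lemma rdotNl M N : rdot (- M) N = - rdot M N.
Proof. by rewrite !(rdotC _ N) rdotNr. Qed.

Lemma rdotBr L M N : rdot L (M - N) = rdot L M - rdot L N.
Proof. by rewrite rdotDr rdotNr. Qed.

Lemma rdotDl L M N : rdot (M + N) L = rdot M L + rdot N L.
Proof. by rewrite !(rdotC _ L) rdotDr. Qed.

Lemma rdotZl c M N : rdot (c%:C%C *: M) N = c * rdot M N.
Proof. by rewrite !(rdotC _ N) rdotZr. Qed.

Lemma rdot0r M : rdot M 0 = 0.
Proof. by rewrite -(subrr M) rdotBr subrr. Qed.

Lemma rdot_sumr (I : finType) (F : I -> 'M[C]_(m, n)) M :
  rdot M (\sum_i F i) = \sum_i rdot M (F i).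
Proof. by apply: (big_morph (rdot M)) => [N L|]; rewrite ?rdotDr ?rdot0r. Qed.

Definition rdot_lin := (rdotDl, rdotDr, rdotNl, rdotNr, rdotZl, rdotZr).

Lemma rdot_normc2 M : rdot M M = \sum_i \sum_j normc2 (M i j).
Proof. by rewrite rdotE; do 2![apply: eq_bigr => ? _]; rewrite /normc2 !expr2. Qed.

Lemma normc2_le_rdot M i j : normc2 (M i j) <= rdot M M.
Proof.
rewrite rdot_normc2 (bigD1 i) //= (bigD1 j) //= -addrA lerDl addr_ge0 //.
  by rewrite sumr_ge0 // => k _; apply: normc2_ge0.
by rewrite !sumr_ge0 // => k _; rewrite sumr_ge0 // => l _; apply: normc2_ge0.
Qed.

Lemma rdot_ge0 M : 0 <= rdot M M.
Proof.
rewrite rdot_normc2 sumr_ge0 // => i _; rewrite sumr_ge0 // => j _.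
exact: normc2_ge0.
Qed.

Lemma rdot_eq0 M : (rdot M M == 0) = (M == 0).
Proof.
apply/eqP/eqP => [M0|->]; last exact: rdot0r.
apply/matrixP => i j; apply/eqP; rewrite mxE -normc2_eq0 eq_le normc2_ge0 andbT.
by rewrite -M0 normc2_le_rdot.
Qed.

Lemma rdot_gt0 M : M != 0 -> 0 < rdot M M.
Proof. by move=> M0; rewrite lt0r rdot_eq0 M0 rdot_ge0. Qed.

End FixedShape.

Lemma rdot_trmxC (m n : nat) (M N : 'M[C]_(m, n)) : rdot (M ^t*) (N ^t*) = rdot M N.
Proof.
rewrite [LHS]rdotE [RHS]rdotE exchange_big.
apply: eq_bigr => i _; apply: eq_bigr => j _.
by rewrite !mxE; case: (M i j) (N i j) => [a b] [c d] /=; ring.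
Qed.

Lemma rdot_cols (m n : nat) (M N : 'M[C]_(m, n)) :
  rdot M N = \sum_j rdot (col j M) (col j N).
Proof.
rewrite rdotE exchange_big; apply: eq_bigr => j _; rewrite rdotE.
by apply: eq_bigr => i _; rewrite big_ord1 !mxE.
Qed.

Lemma rdot_adj (m n k : nat) (A : 'M[C]_(m, n)) (U : 'M_(m, k)) (V : 'M_(n, k)) :
  rdot U (A *m V) = rdot (A ^t* *m U) V.
Proof. by rewrite !rdot.unlock trmxC_mul trmxCK mulmxA. Qed.

Lemma rdot_conj (m n : nat) (A : 'M[C]_(m, n)) (M : 'M[C]_m) (v : 'cV_n) :
  rdot v (A ^t* *m M *m A *m v) = rdot (A *m v) (M *m (A *m v)).
Proof. by rewrite -!mulmxA [LHS]rdot_adj trmxCK. Qed.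

End RealInnerProduct.

(* Abstracting the inner products first spares [lra] costly conversion tests
   between matrix expressions. *)
Ltac rdot_lra :=
  repeat match goal with |- context [rdot ?u ?v] => move: (rdot u v) end;
  intros; lra.

Section FrobeniusNorm.
Variables (R : rcfType) (m n : nat).
Implicit Types (c : R) (L M N : 'M[R[i]]_(m, n)).

Lemma rdot_CauchySchwarz M N : rdot M N ^+ 2 <= rdot M M * rdot N N.
Proof.
have [->|/rdot_gt0 N0] := eqVneq N 0; first by rewrite !rdot0r expr0n mulr0.
have := rdot_ge0 ((rdot N N)%:C%C *: M - (rdot M N)%:C%C *: N).
rewrite !rdot_lin (rdotC N M); move: N0.
move: (rdot M M) (rdot N N) (rdot M N) => a b r b0 ge0.
by rewrite -subr_ge0 -(pmulr_rge0 _ b0); lra.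
Qed.

Definition fnorm M : R := Num.sqrt (rdot M M).

Lemma fnorm_ge0 M : 0 <= fnorm M.
Proof. exact: sqrtr_ge0. Qed.

Lemma sqr_fnorm M : fnorm M ^+ 2 = rdot M M.
Proof. by rewrite sqr_sqrtr ?rdot_ge0. Qed.

Lemma fnorm_eq0 M : (fnorm M == 0) = (M == 0).
Proof. by rewrite -rdot_eq0 -sqr_fnorm sqrf_eq0. Qed.

Lemma fnorm_le_sqr M c : 0 <= c -> (fnorm M <= c) = (rdot M M <= c ^+ 2).
Proof. by move=> c0; rewrite -sqr_fnorm ler_sqr ?nnegrE ?fnorm_ge0. Qed.

Lemma rdot_le_fnorm M N : rdot M N <= fnorm M * fnorm N.
Proof.
rewrite -sqrtrM ?rdot_ge0 // (le_trans (ler_norm _)) // -sqrtr_sqr.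
by rewrite ler_wsqrtr // rdot_CauchySchwarz.
Qed.

Lemma fnormD M N : fnorm (M + N) <= fnorm M + fnorm N.
Proof.
rewrite fnorm_le_sqr ?addr_ge0 ?fnorm_ge0 // !rdot_lin (rdotC N M) -!sqr_fnorm.
by have := rdot_le_fnorm M N; rdot_lra.
Qed.

Lemma fnormZ c M : fnorm (c%:C%C *: M) = `|c| * fnorm M.
Proof.
by rewrite /fnorm rdotZl rdotZr mulrA -expr2 sqrtrM ?sqr_ge0 // sqrtr_sqr.
Qed.

Lemma fnormN M : fnorm (- M) = fnorm M.
Proof. by rewrite /fnorm rdotNl rdotNr opprK. Qed.

Lemma fnorm_distC M N : fnorm (M - N) = fnorm (N - M).
Proof. by rewrite -opprB fnormN. Qed.

Lemma fnorm_distD L M N : fnorm (M - N) <= fnorm (M - L) + fnorm (L - N).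
Proof. by apply: le_trans (fnormD _ _); rewrite addrA subrK. Qed.

Lemma fnorm_sum (I : finType) (F : I -> 'M[R[i]]_(m, n)) :
  fnorm (\sum_i F i) <= \sum_i fnorm (F i).
Proof.
apply: (big_ind2 (fun M c => fnorm M <= c)) => // [|M c N d Mc Nd].
  by rewrite /fnorm rdot0r sqrtr0.
exact: le_trans (fnormD M N) (lerD Mc Nd).
Qed.

Lemma norm_Re_le_fnorm M i j : `|complex.Re (M i j)| <= fnorm M.
Proof.
rewrite -sqrtr_sqr ler_wsqrtr // (le_trans _ (normc2_le_rdot M i j)) //.
by rewrite lerDl sqr_ge0.
Qed.

Lemma norm_Im_le_fnorm M i j : `|complex.Im (M i j)| <= fnorm M.
Proof.
rewrite -sqrtr_sqr ler_wsqrtr // (le_trans _ (normc2_le_rdot M i j)) //.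
by rewrite lerDr sqr_ge0.
Qed.

End FrobeniusNorm.

Section OperatorNorm.
Variable R : rcfType.
Local Notation C := R[i].

Lemma fnorm_trmxC (m n : nat) (M : 'M[C]_(m, n)) : fnorm (M ^t*) = fnorm M.
Proof. by rewrite /fnorm rdot_trmxC. Qed.

Definition opnorm2_le (m n : nat) (A : 'M[C]_(m, n)) (a : R) :=
  forall v : 'cV_n, rdot (A *m v) (A *m v) <= a * rdot v v.

Lemma opnorm2_le_trmxC (m n : nat) (A : 'M[C]_(m, n)) (a : R) :
  0 <= a -> opnorm2_le A a -> opnorm2_le (A ^t*) a.
Proof.
move=> a0 normA v; set w := A ^t* *m v.
have [->|/rdot_gt0 w0] := eqVneq w 0; first by rewrite rdot0r mulr_ge0 ?rdot_ge0.
have := rdot_CauchySchwarz v (A *m w); rewrite rdot_adj -/w => cs.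
rewrite -(ler_pM2l w0) -expr2 (le_trans cs) // mulrC mulrA ler_wpM2r ?rdot_ge0 //.
by rewrite mulrC; apply: normA.
Qed.

Lemma rdot_mulmx_le (m n k : nat) (A : 'M[C]_(m, n)) (M : 'M[C]_(n, k)) (a : R) :
  opnorm2_le A a -> rdot (A *m M) (A *m M) <= a * rdot M M.
Proof.
move=> normA; rewrite rdot_cols (rdot_cols M) mulr_sumr; apply: ler_sum => j _.
by rewrite !colE -mulmxA; apply: normA.
Qed.

Lemma fnorm_conj_le (m n : nat) (A : 'M[C]_(m, n)) (M : 'M[C]_m) (a : R) :
  0 <= a -> opnorm2_le A a -> fnorm (A ^t* *m M *m A) <= a * fnorm M.
Proof.
move=> a0 normA; have normA' := opnorm2_le_trmxC a0 normA.
rewrite fnorm_le_sqr ?mulr_ge0 ?fnorm_ge0 // exprMn sqr_fnorm expr2 -mulrA -mulmxA.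
apply: (le_trans (rdot_mulmx_le _ normA')); rewrite ler_wpM2l //.
by rewrite -rdot_trmxC trmxC_mul (le_trans (rdot_mulmx_le _ normA')) // rdot_trmxC.
Qed.

End OperatorNorm.

(** * Functional calculus of Hermitian matrices *)

Section UnitaryDiagonalization.
Variables (C : numClosedFieldType) (n : nat).
Implicit Types (U V : 'M[C]_n) (d e : 'rV[C]_n).

Lemma unitarymxK U : U \is unitarymx -> U ^t* *m U = 1%:M.
Proof. by rewrite -trmxC_unitary => /unitarymxP; rewrite trmxCK. Qed.

Definition udiag_mx U d : 'M[C]_n := U *m diag_mx d *m U ^t*.

Lemma udiag_mx_trmxC U d : (udiag_mx U d) ^t* = udiag_mx U (map_mx Num.conj d).
Proof.
by rewrite /udiag_mx !trmx_mul !map_mxM trmxCK mulmxA tr_diag_mx map_diag_mx.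
Qed.

Lemma udiag_mx_spectral (M : 'M[C]_n) : M \is hermsymmx ->
  M = udiag_mx ((spectralmx M) ^t*) (spectral_diag M).
Proof.
move=> /hermitian_normalmx /orthomx_spectralP {1}->.
by rewrite invmx_unitary ?spectral_unitarymx // /udiag_mx trmxCK.
Qed.

Lemma udiag_mxM U d e : U \is unitarymx ->
  udiag_mx U d *m udiag_mx U e = udiag_mx U (\row_i (d 0 i * e 0 i)).
Proof.
move=> unitU; rewrite /udiag_mx !mulmxA -(mulmxA _ (U ^t*) U) unitarymxK // mulmx1.
by rewrite -(mulmxA U) mulmx_diag.
Qed.

Lemma udiag_mx_const U c : U \is unitarymx -> udiag_mx U (const_mx c) = c%:M.
Proof.
move=> /unitarymxP UU; rewrite /udiag_mx diag_const_mx scalar_mxC -mulmxA UU.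
exact: mulmx1.
Qed.

Lemma udiag_mx_col U d i : U \is unitarymx ->
  udiag_mx U d *m col i U = d 0 i *: col i U.
Proof.
move=> unitU; rewrite /udiag_mx !colE !mulmxA -(mulmxA _ (U ^t*)) unitarymxK // mulmx1.
rewrite -!mulmxA scalemxAr; congr (_ *m _); apply/colP => j.
rewrite mul_diag_mx !mxE andbT.
by have [->|] := eqVneq j i; rewrite ?mulr1n ?mulr1 // mulr0n !mulr0.
Qed.

Lemma udiag_mx_conjB U V d e : U \is unitarymx -> V \is unitarymx ->
  V ^t* *m (udiag_mx U d - udiag_mx V e) *m U =
  \matrix_(i, j) ((V ^t* *m U) i j * (d 0 j - e 0 i)).
Proof.
move=> unitU unitV; rewrite mulmxBr mulmxBl !mulmxA (unitarymxK unitV) mul1mx.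
rewrite -[X in X - _]mulmxA (unitarymxK unitU) mulmx1 -[X in _ - X]mulmxA.
apply/matrixP => i j; rewrite mul_mx_diag mul_diag_mx !mxE mulrBr.
by congr (_ - _); apply: mulrC.
Qed.

End UnitaryDiagonalization.

HB.lock Definition spec_mx (R : rcfType) (n : nat) (U : 'M[R[i]]_n)
  (d : 'I_n -> R) : 'M[R[i]]_n := udiag_mx U (\row_i (d i)%:C%C).

Section SpectralForm.
Variables (R : rcfType) (n : nat).
Implicit Types (v : 'cV[R[i]]_n) (M U V : 'M[R[i]]_n) (d e : 'I_n -> R) (c b : R).

Definition loewner_le M N := forall v, rdot v (M *m v) <= rdot v (N *m v).

Lemma loewner_scalarP M c :
  loewner_le c%:C%C%:M M <-> forall v, c * rdot v v <= rdot v (M *m v).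
Proof. by split=> h v; have := h v; rewrite mul_scalar_mx rdotZr. Qed.

Lemma eq_spec_mx U d e : d =1 e -> spec_mx U d = spec_mx U e.
Proof.
by move=> de; rewrite spec_mx.unlock; congr udiag_mx; apply/rowP => i; rewrite !mxE de.
Qed.

Lemma spec_mx_herm U d : (spec_mx U d) ^t* = spec_mx U d.
Proof.
rewrite spec_mx.unlock udiag_mx_trmxC; congr udiag_mx.
by apply/rowP => i; rewrite !mxE; apply: conjc_real.
Qed.

Lemma spec_mxM U d e : U \is unitarymx ->
  spec_mx U d *m spec_mx U e = spec_mx U (fun i => d i * e i).
Proof.
move=> unitU; rewrite spec_mx.unlock (udiag_mxM _ _ unitU); congr udiag_mx.
by apply/rowP => i; rewrite !mxE -rmorphM.
Qed.

Lemma spec_mx_const U c : U \is unitarymx -> spec_mx U (fun=> c) = c%:C%C%:M.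
Proof.
move=> unitU; rewrite spec_mx.unlock -(udiag_mx_const _ unitU); congr udiag_mx.
by apply/rowP => i; rewrite !mxE.
Qed.

Lemma rdot_spec_mx U d v :
  rdot v (spec_mx U d *m v) = \sum_i d i * normc2 ((U ^t* *m v) i 0).
Proof.
rewrite spec_mx.unlock /udiag_mx -!mulmxA rdot_adj rdotE; apply: eq_bigr => i _.
move: (U ^t* *m v) => w; rewrite big_ord1 mul_diag_mx !mxE /normc2.
by case: (w i 0) => a b /=; ring.
Qed.

Lemma spec_mx_le U d e :
  (forall i, d i <= e i) -> loewner_le (spec_mx U d) (spec_mx U e).
Proof.
move=> de v; rewrite !rdot_spec_mx; apply: ler_sum => i _.
by rewrite ler_wpM2r ?normc2_ge0.
Qed.

Lemma spec_mx_col U d i : U \is unitarymx ->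
  spec_mx U d *m col i U = (d i)%:C%C *: col i U.
Proof.
by move=> unitU; rewrite spec_mx.unlock (udiag_mx_col _ _ unitU) mxE.
Qed.

Lemma rdot_col_unitary U i : U \is unitarymx -> rdot (col i U) (col i U) = 1.
Proof.
move=> /unitarymxK /matrixP /(_ i i); rewrite rdot.unlock /mxtrace big_ord1.
rewrite !mxE eqxx => E.
have -> : \sum_j (col i U) ^t* 0 j * col i U j 0 = 1 :> R[i]; last by [].
by rewrite -[RHS]E; apply: eq_bigr => j _; rewrite !mxE.
Qed.

Lemma rdot_spec_mx_col U d i : U \is unitarymx ->
  rdot (col i U) (spec_mx U d *m col i U) = d i.
Proof. by move=> unitU; rewrite spec_mx_col // rdotZr rdot_col_unitary // mulr1. Qed.

Lemma col_unitary_neq0 U i : U \is unitarymx -> col i U != 0.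
Proof. by move=> unitU; rewrite -rdot_eq0 rdot_col_unitary // oner_neq0. Qed.

Lemma spec_mx_spectral M : M ^t* = M ->
  M = spec_mx ((spectralmx M) ^t*) (fun i => complex.Re (spectral_diag M 0 i)).
Proof.
move=> hermM.
have hermsymM : M \is hermsymmx by apply/is_hermitianmxP; rewrite expr0 scale1r hermM.
rewrite {1}(udiag_mx_spectral hermsymM) spec_mx.unlock; congr udiag_mx.
apply/rowP => i; rewrite !mxE.
have /mxOverP /(_ 0 i) := hermitian_spectral_diag_real hermsymM.
by move=> /RRe_real ->.
Qed.

Lemma spectralmx_trmxC_unitary M : (spectralmx M) ^t* \is unitarymx.
Proof. by rewrite trmxC_unitary spectral_unitarymx. Qed.

Lemma spec_mxP M : M ^t* = M -> exists U d, U \is unitarymx /\ M = spec_mx U d.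
Proof.
move=> /spec_mx_spectral E; do 2!eexists.
by split; [exact: spectralmx_trmxC_unitary | exact: E].
Qed.

Lemma spec_mx_geP M b : M ^t* = M -> loewner_le b%:C%C%:M M ->
  exists U d, [/\ U \is unitarymx, forall i, b <= d i & M = spec_mx U d].
Proof.
move=> /spec_mxP [U [d [unitU ->]]] /loewner_scalarP bM; exists U, d; split=> // i.
by have := bM (col i U); rewrite rdot_spec_mx_col // rdot_col_unitary // mulr1.
Qed.

Lemma rdot_unitary_conj U V M : U \is unitarymx -> V \is unitarymx ->
  rdot (V ^t* *m M *m U) (V ^t* *m M *m U) = rdot M M.
Proof.
move=> /unitarymxP UU /unitarymxP VV.
rewrite -mulmxA [LHS]rdot_adj trmxCK mulmxA VV mul1mx.
rewrite -rdot_trmxC trmxC_mul [LHS]rdot_adj trmxCK mulmxA UU mul1mx.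
exact: rdot_trmxC.
Qed.

(* Unitary invariance: with [W = V^* U], conjugating the difference by [V^*] and
   [U] turns it into [W D - E W] for the two diagonal matrices [D] and [E]. *)
Lemma rdot_spec_mxB U V d e : U \is unitarymx -> V \is unitarymx ->
  let M := spec_mx U d - spec_mx V e in
  rdot M M = \sum_i \sum_j normc2 ((V ^t* *m U) i j) * (d j - e i) ^+ 2.
Proof.
move=> unitU unitV M; rewrite -(rdot_unitary_conj _ unitU unitV) rdot_normc2.
rewrite /M spec_mx.unlock (udiag_mx_conjB _ _ unitU unitV).
by do 2![apply: eq_bigr => ? _]; rewrite !mxE -normc2Z -rmorphB.
Qed.

End SpectralForm.

Section FunctionalCalculus.
Variables (R : rcfType) (n : nat).
Implicit Types (M N U V : 'M[R[i]]_n) (d e : 'I_n -> R) (f g : R -> R) (b c L : R).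

Definition fcalc f M : 'M[R[i]]_n :=
  spec_mx ((spectralmx M) ^t*) (fun i => f (complex.Re (spectral_diag M 0 i))).

Lemma fcalc_herm f M : (fcalc f M) ^t* = fcalc f M.
Proof. exact: spec_mx_herm. Qed.

(* By [rdot_spec_mxB], equality forces [d j = e i] wherever [(V^* U) i j] is
   nonzero; hence the same sum for [f \o d] and [f \o e] vanishes too. *)
Lemma eq_spec_mx_comp f U V d e : U \is unitarymx -> V \is unitarymx ->
  spec_mx U d = spec_mx V e -> spec_mx U (f \o d) = spec_mx V (f \o e).
Proof.
move=> unitU unitV /eqP; rewrite -subr_eq0 -rdot_eq0 rdot_spec_mxB // => /eqP sum0.
have term_ge0 i j : 0 <= normc2 ((V ^t* *m U) i j) * (d j - e i) ^+ 2.
  by rewrite mulr_ge0 ?normc2_ge0 ?sqr_ge0.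
apply/eqP; rewrite -subr_eq0 -rdot_eq0 rdot_spec_mxB // big1 // => i _.
rewrite big1 // => j _; have := sum0.
move/psumr_eq0P => /(_ (fun k _ => sumr_ge0 _ (fun l _ => term_ge0 k l)) i isT).
move/psumr_eq0P => /(_ (fun l _ => term_ge0 i l) j isT) /eqP /=.
rewrite mulf_eq0 sqrf_eq0 subr_eq0 => /orP[/eqP ->|/eqP ->]; first by rewrite mul0r.
by rewrite subrr expr0n mulr0.
Qed.

Lemma fcalc_spec f U d : U \is unitarymx ->
  fcalc f (spec_mx U d) = spec_mx U (f \o d).
Proof.
move=> unitU; have hermM := spec_mx_spectral (spec_mx_herm U d).
exact/esym/(eq_spec_mx_comp f unitU (spectralmx_trmxC_unitary _) hermM).
Qed.

Lemma fcalc_le f g M : (forall x, f x <= g x) -> loewner_le (fcalc f M) (fcalc g M).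
Proof. by move=> fg; apply: spec_mx_le => i; apply: fg. Qed.

Lemma fcalc_const c M : fcalc (fun=> c) M = c%:C%C%:M.
Proof. exact/spec_mx_const/spectralmx_trmxC_unitary. Qed.

Lemma eq_fcalc_ge b f g M : M ^t* = M -> loewner_le b%:C%C%:M M ->
  (forall x, b <= x -> f x = g x) -> fcalc f M = fcalc g M.
Proof.
move=> hermM /(spec_mx_geP hermM) [U [d [unitU bd ->]]] fg.
by rewrite !fcalc_spec //; apply: eq_spec_mx => i; apply: fg.
Qed.

Lemma fcalc_lipschitz L f M N : M ^t* = M -> N ^t* = N -> 0 <= L ->
  (forall x y, `|f x - f y| <= L * `|x - y|) ->
  fnorm (fcalc f M - fcalc f N) <= L * fnorm (M - N).
Proof.
move=> /spec_mxP [U [d [unitU ->]]] /spec_mxP [V [e [unitV ->]]] L0 lipf.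
rewrite !fcalc_spec // fnorm_le_sqr ?mulr_ge0 ?fnorm_ge0 // exprMn sqr_fnorm.
rewrite !rdot_spec_mxB // mulr_sumr; apply: ler_sum => i _.
rewrite mulr_sumr; apply: ler_sum => j _; rewrite [leRHS]mulrCA.
rewrite ler_wpM2l ?normc2_ge0 //.
rewrite -exprMn -[leLHS]real_normK ?num_real // -[leRHS]real_normK ?num_real //.
by rewrite ler_sqr ?nnegrE // normrM (ger0_norm L0); apply: lipf.
Qed.

End FunctionalCalculus.

#[local] Bind Scope ring_scope with R.
#[local] Arguments Un_cv _ _%_ring_scope.
#[local] Arguments Rpower (_ _)%_ring_scope.

(** * Completeness and contractions *)

Section RealSequences.
Implicit Types (u : nat -> R) (l e k c : R).

Lemma Un_cvP u l : Un_cv u l <->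
  forall e, 0 < e -> exists N, forall m, (N <= m)%N -> `|u m - l| < e.
Proof.
split=> cv e /RltP /cv [N uN]; exists N => m /ssrnat.leP /uN; rewrite RdistE.
  by move=> /RltP.
by move/RltP.
Qed.

Lemma Un_cv_sum (I : finType) (a : I -> nat -> R) (l : I -> R) :
  (forall i, Un_cv (a i) (l i)) -> Un_cv (fun m => \sum_i a i m) (\sum_i l i).
Proof.
move=> cv; elim: (index_enum I) => [|i s IH].
  by apply/Un_cvP => e e0; exists 0%N => m _; rewrite !big_nil subrr normr0.
rewrite big_cons; apply: Un_cv_ext (CV_plus _ _ _ _ (cv i) IH) => m.
by rewrite big_cons.
Qed.

Lemma Un_cv_sqr_dist u l : Un_cv u l -> Un_cv (fun m => (u m - l) ^+ 2) 0.
Proof.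
move=> cv; have cv0 : Un_cv (fun m => u m - l) 0.
  apply/Un_cvP => e /((Un_cvP u l).1 cv) [N uN]; exists N => m.
  by rewrite subr0; apply: uN.
by rewrite -(mulr0 0); apply: CV_mult.
Qed.

Lemma expr_mul_lt k c e : 0 <= k < 1 -> 0 <= c -> 0 < e ->
  exists N, forall m, (N <= m)%N -> k ^+ m * c < e.
Proof.
move=> /andP[k0 k1] c0 e0; have c1 : 0 < c + 1 by lra.
have [||N kN] := pow_lt_1_zero k _ (e / (c + 1)).
- by rewrite RabsE ger0_norm //; apply/RltP.
- by apply/RltP; rewrite divr_gt0.
exists N => m /ssrnat.leP /kN /RltP; rewrite RpowE RabsE ger0_norm ?exprn_ge0 //.
rewrite ltr_pdivlMr // => /(le_lt_trans _); apply.
by rewrite ler_wpM2l ?exprn_ge0 // lerDl.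
Qed.

End RealSequences.

Section ContractionPrinciple.
Variables m n : nat.
Implicit Types (Y Z : 'M[R[i]]_(m, n)) (e : R).

Lemma fnorm_complete (Ys : nat -> 'M[R[i]]_(m, n)) :
  (forall e, 0 < e -> exists N, forall k l, (N <= k)%N -> (N <= l)%N ->
     fnorm (Ys k - Ys l) < e) ->
  exists Y, forall e, 0 < e -> exists N, forall k, (N <= k)%N ->
     fnorm (Ys k - Y) < e.
Proof.
move=> cauchy.
have coord_cv (f : 'M[R[i]]_(m, n) -> R) :
    (forall Y Z, f Y - f Z = f (Y - Z)) -> (forall Y, `|f Y| <= fnorm Y) ->
    {l | Un_cv (fun k => f (Ys k)) l}.
  move=> fB f_le; apply: R_complete => e /RltP /cauchy [N YN].
  exists N => k l /ssrnat.leP Nk /ssrnat.leP Nl; apply/RltP; rewrite RdistE fB.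
  exact: le_lt_trans (f_le _) (YN _ _ Nk Nl).
have reB i j Y Z : complex.Re (Y i j) - complex.Re (Z i j) = complex.Re ((Y - Z) i j).
  by rewrite -raddfB !mxE.
have imB i j Y Z : complex.Im (Y i j) - complex.Im (Z i j) = complex.Im ((Y - Z) i j).
  by rewrite -raddfB !mxE.
have re_cv i j := coord_cv _ (reB i j) (fun Y => norm_Re_le_fnorm Y i j).
have im_cv i j := coord_cv _ (imB i j) (fun Y => norm_Im_le_fnorm Y i j).
pose Y : 'M[R[i]]_(m, n) := \matrix_(i, j) (sval (re_cv i j) +i* sval (im_cv i j))%C.
have cv : Un_cv (fun k => rdot (Ys k - Y) (Ys k - Y)) 0.
  have -> : 0 = \sum_(i < m) \sum_(j < n) (0 + 0) :> R.
    by rewrite big1 // => i _; rewrite big1 ?addr0.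
  apply: Un_cv_ext => [k|]; first by rewrite rdot_normc2.
  apply: Un_cv_sum => i; apply: Un_cv_sum => j.
  apply: Un_cv_ext (CV_plus _ _ _ _ (Un_cv_sqr_dist (svalP (re_cv i j)))
                                    (Un_cv_sqr_dist (svalP (im_cv i j)))) => k.
  by rewrite /normc2 -reB -imB !mxE.
exists Y => e e0; have [N YN] := (Un_cvP _ _).1 cv _ (exprn_gt0 2 e0).
exists N => k /YN; rewrite subr0 ger0_norm ?rdot_ge0 // -sqr_fnorm.
by rewrite ltr_sqr ?nnegrE ?fnorm_ge0 // ltW.
Qed.

(* Palais' form of the argument: the distance of any two points is controlled by
   their residuals [F Y - Y], and these decay geometrically along the iterates. *)
Lemma contraction_fixed_point (F : 'M[R[i]]_(m, n) -> 'M[R[i]]_(m, n)) (k : R) :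
  0 <= k < 1 -> (forall Y Z, fnorm (F Y - F Z) <= k * fnorm (Y - Z)) ->
  exists Y, F Y = Y.
Proof.
move=> k01 Fk; have /andP[k0 k1] := k01.
pose res Y := fnorm (F Y - Y).
have dist_le Y Z : (1 - k) * fnorm (Y - Z) <= res Y + res Z.
  have := fnorm_distD (F Y) Y Z; have := fnorm_distD (F Z) (F Y) Z; have := Fk Y Z.
  by rewrite (fnorm_distC Y (F Y)) -/(res Y) -/(res Z); lra.
pose Ys l := iter l F 0.
have res_le l : res (Ys l) <= k ^+ l * res 0.
  elim: l => [|l IH]; first by rewrite mul1r.
  by rewrite exprS -mulrA (le_trans (Fk _ _)) // ler_wpM2l.
have res_lt e : 0 < e -> exists N, forall l, (N <= l)%N -> res (Ys l) < e.
  move=> e0; have [N resN] := expr_mul_lt k01 (fnorm_ge0 (F 0 - 0)) e0.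
  by exists N => l /resN; apply: le_lt_trans; apply: res_le.
have [|Y cvY] := @fnorm_complete Ys.
  move=> e e0; have subk_gt0 : 0 < 1 - k by rewrite subr_gt0.
  have [N resN] := res_lt _ (mulr_gt0 subk_gt0 (divr_gt0 e0 (ltr0Sn _ 1))).
  exists N => l l' /resN res_l /resN res_l'.
  by rewrite -(ltr_pM2l subk_gt0) (le_lt_trans (dist_le _ _)) //; lra.
exists Y; apply/eqP; rewrite -subr_eq0 -fnorm_eq0 eq_le fnorm_ge0 andbT.
apply/ler_addgt0Pl => e e0; rewrite addr0; have e3 : 0 < e / 3 by rewrite divr_gt0.
have [N YN] := cvY _ e3; have [N' resN] := res_lt _ e3.
pose l := maxn N N'; have lY := YN l (leq_maxl _ _); have lres := resN l (leq_maxr _ _).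
have := fnorm_distD (F (Ys l)) (F Y) Y; have := fnorm_distD (Ys l) (F (Ys l)) Y.
have := Fk Y (Ys l); have := fnorm_ge0 (Ys l - Y).
rewrite (fnorm_distC Y) -/(res (Ys l)); move: lY lres.
by move: (fnorm (Ys l - Y)) => d; nra.
Qed.

End ContractionPrinciple.

(** * Real powers and the Loewner-Heinz inequality *)

Lemma midpoint_dense (S : R -> Prop) :
  S 0 -> S 1 -> (forall x y, S x -> S y -> S ((x + y) / 2)) ->
  forall r e : R, 0 <= r <= 1 -> 0 < e -> exists2 y, S y & `|y - r| < e.
Proof.
move=> S0 S1 Smid r e /andP[r0 r1] e0.
have bisect N : exists l h, [/\ S l, S h, l <= r, r <= h & h - l <= 2^-1 ^+ N].
  elim: N => [|N [l [h [Sl Sh lr rh hl]]]]; first by exists 0, 1; split=> //; lra.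
  have [mr|/ltW rm] := leP ((l + h) / 2) r.
    by exists ((l + h) / 2), h; split=> //; [exact: Smid | rewrite exprS; lra].
  by exists l, ((l + h) / 2); split=> //; [exact: Smid | rewrite exprS; lra].
have half01 : 0 <= (2^-1 : R) < 1 by apply/andP; split; lra.
have [N ltN] := expr_mul_lt half01 ler01 e0.
have [l [h [Sl _ lr rh hl]]] := bisect N; exists l => //.
by have := ltN N (leqnn N); rewrite mulr1 ler0_norm; lra.
Qed.

Lemma continuity_adherent_ge0 (f : R -> R) (x : R) : continuity f ->
  (forall e : R, 0 < e -> exists2 y, 0 <= f y & `|y - x| < e) -> 0 <= f x.
Proof.
move=> cf adh; rewrite leNgt; apply/negP => fx.
have [|e [/RltP e0 fe]] := cf x (- f x); first by apply/RltP; rewrite oppr_gt0.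
have [y fy yx] := adh e e0; have [xy|/eqP xy] := eqVneq x y.
  by move: fx; rewrite xy ltNge fy.
have /RltP : Rlt (Rdist (f y) (f x)) (- f x).
  by apply: fe; split; [split | rewrite /= RdistE; apply/RltP].
by rewrite RdistE; have := ler_norm (f y - f x); lra.
Qed.

Section PositiveDefinite.
Variables (R : rcfType) (n : nat).
Implicit Types (M : 'M[R[i]]_n) (b : R).

Definition posdef M := M ^t* = M /\ forall v : 'cV_n, v != 0 -> 0 < rdot v (M *m v).

Lemma posdefP M : posdef M <->
  exists U d, [/\ U \is unitarymx, forall i, 0 < d i & M = spec_mx U d].
Proof.
split=> [[/spec_mxP [U [d [unitU ->]]] pos]|[U [d [unitU d0 ->]]]].
  exists U, d; split=> // i.
  by rewrite -(rdot_spec_mx_col d i unitU); apply/pos/col_unitary_neq0.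
split=> [|v v0]; first exact: spec_mx_herm.
have w0 : U ^t* *m v != 0.
  apply: contra_neq v0 => /(congr1 (mulmx U)).
  by rewrite mulmxA (unitarymxP unitU) mul1mx mulmx0.
have term_ge0 i : 0 <= d i * normc2 ((U ^t* *m v) i 0).
  by rewrite mulr_ge0 ?normc2_ge0 ?ltW.
rewrite rdot_spec_mx lt0r sumr_ge0 // andbT psumr_neq0 //.
have /matrix0Pn [i [j wi]] := w0; apply/hasP; exists i; first exact: mem_index_enum.
by rewrite /= mulr_gt0 // lt0r normc2_ge0 normc2_eq0 andbT -(ord1 j).
Qed.

Lemma posdef_herm M : posdef M -> M ^t* = M.
Proof. by case. Qed.

Lemma loewner_ge_posdef b M : 0 < b -> M ^t* = M -> loewner_le b%:C%C%:M M -> posdef M.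
Proof.
move=> b0 hermM /loewner_scalarP bM; split=> // v v0; apply: lt_le_trans (bM v).
by rewrite mulr_gt0 // rdot_gt0.
Qed.

End PositiveDefinite.

HB.lock Definition mxpow (n : nat) (M : 'M[R[i]]_n) (r : R) : 'M[R[i]]_n :=
  fcalc (fun x => Rpower x r) M.

Section RealPowers.
Variable n : nat.
Local Notation MC := 'M[R[i]]_n.
Implicit Types (A B M P S : MC) (v w : 'cV[R[i]]_n) (r u b : R).

Lemma Rpower_gt0 x r : 0 < Rpower x r.
Proof. by apply/RltP; apply: exp_pos. Qed.

Lemma mxpow_spec (U : MC) d r : U \is unitarymx ->
  mxpow (spec_mx U d) r = spec_mx U (fun i => Rpower (d i) r).
Proof. by move=> unitU; rewrite mxpow.unlock fcalc_spec. Qed.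

Lemma mxpow_herm M r : (mxpow M r) ^t* = mxpow M r.
Proof. by rewrite mxpow.unlock fcalc_herm. Qed.

Lemma mxpow_posdef M r : posdef M -> posdef (mxpow M r).
Proof.
move=> /posdefP [U [d [unitU d0 ->]]]; apply/posdefP.
exists U, (fun i => Rpower (d i) r).
by split=> // [i|]; [exact: Rpower_gt0 | exact: mxpow_spec].
Qed.

Lemma mxpowD M r u : posdef M -> mxpow M (r + u) = mxpow M r *m mxpow M u.
Proof.
move=> /posdefP [U [d [unitU _ ->]]]; rewrite !mxpow_spec // spec_mxM //.
by apply: eq_spec_mx => i; rewrite Rpower_plus.
Qed.

Lemma mxpow0 M : posdef M -> mxpow M 0 = 1%:M.
Proof.
move=> /posdefP [U [d [unitU d0 ->]]]; rewrite mxpow_spec // -(spec_mx_const 1 unitU).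
by apply: eq_spec_mx => i; apply: Rpower_O; apply/RltP.
Qed.

Lemma mxpow1 M : posdef M -> mxpow M 1 = M.
Proof.
move=> /posdefP [U [d [unitU d0 ->]]]; rewrite mxpow_spec //.
by apply: eq_spec_mx => i; apply: Rpower_1; apply/RltP.
Qed.

Lemma mxpowM M r u : posdef M -> mxpow (mxpow M r) u = mxpow M (r * u).
Proof.
move=> /posdefP [U [d [unitU _ ->]]]; rewrite !mxpow_spec //.
by apply: eq_spec_mx => i; rewrite Rpower_mult.
Qed.

Lemma mxpow_mulA M r u v : posdef M ->
  mxpow M r *m (mxpow M u *m v) = mxpow M (r + u) *m v.
Proof. by move=> posM; rewrite mulmxA mxpowD. Qed.

Lemma mxpowNK M r v : posdef M -> mxpow M (- r) *m (mxpow M r *m v) = v.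
Proof. by move=> posM; rewrite mxpow_mulA // addNr mxpow0 // mul1mx. Qed.

Lemma mxpowKN M r v : posdef M -> mxpow M r *m (mxpow M (- r) *m v) = v.
Proof. by move=> posM; rewrite mxpow_mulA // subrr mxpow0 // mul1mx. Qed.

Lemma rdot_mxpow M r v w : rdot (mxpow M r *m v) w = rdot v (mxpow M r *m w).
Proof. by rewrite rdot_adj mxpow_herm. Qed.

Lemma rdot_mxpowD M r u v w : posdef M ->
  rdot (mxpow M r *m v) (mxpow M u *m w) = rdot v (mxpow M (r + u) *m w).
Proof. by move=> posM; rewrite rdot_mxpow mxpow_mulA. Qed.

Lemma mxpow_ge M r b : 0 < b -> 0 <= r -> M ^t* = M -> loewner_le b%:C%C%:M M ->
  loewner_le (Rpower b r)%:C%C%:M (mxpow M r).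
Proof.
move=> /RltP b0 /RleP r0 hermM /(spec_mx_geP hermM) [U [d [unitU bd ->]]].
rewrite mxpow_spec // -(spec_mx_const _ unitU); apply: spec_mx_le => i.
by apply/RleP; apply: Rle_Rpower_l => //; split=> //; apply/RleP.
Qed.

(* A generalized eigenvector of the pair [(S, P)] is [P^(-1/2)] applied to an
   eigenvector of [P^(-1/2) S P^(-1/2)]. *)
Lemma loewner_le_generalized_eigenvalue S P : S ^t* = S -> posdef P ->
  (forall (l : R) (x : 'cV_n), x != 0 -> S *m x = l%:C%C *: (P *m x) -> l <= 1) ->
  loewner_le S P.
Proof.
move=> hermS posP le1; pose K := mxpow P (- 2^-1).
have [W [l [unitW KSKE]]] : exists W l, W \is unitarymx /\ K *m S *m K = spec_mx W l.
  by apply: spec_mxP; rewrite !trmxC_mul hermS mxpow_herm mulmxA.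
have sqrtP v : mxpow P 2^-1 *m (mxpow P 2^-1 *m v) = P *m v.
  by rewrite mxpow_mulA // (_ : 2^-1 + 2^-1 = 1) ?mxpow1 //; lra.
have l_le1 i : l i <= 1.
  pose w := col i W; have wE : mxpow P 2^-1 *m (K *m w) = w by exact: mxpowKN.
  apply: (le1 _ (K *m w)).
    apply: contra_neq (col_unitary_neq0 i unitW); rewrite -/w -{2}wE => ->.
    exact: mulmx0.
  have := congr1 (mulmx (mxpow P 2^-1)) (spec_mx_col l i unitW).
  by rewrite -KSKE -!mulmxA mxpowKN // => ->; rewrite -scalemxAr -sqrtP wE.
move=> v; pose y := mxpow P 2^-1 *m v.
have := spec_mx_le W l_le1 y; rewrite -KSKE (spec_mx_const _ unitW) mul1mx -!mulmxA.
by rewrite mxpowNK // -(rdot_mxpow P) mxpowNK // /y rdot_mxpow sqrtP.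
Qed.

(* Pedersen's argument: with [m = (r + u) / 2], pair [B^m x = l A^m x] with
   [A^((u - r) / 2) x] and use both hypotheses to get [l <x, A^u x> <= <x, A^u x>]. *)
Lemma mxpow_midpoint_eigenvalue_le1 A B r u (l : R) (x : 'cV_n) :
  posdef A -> posdef B ->
  loewner_le (mxpow B r) (mxpow A r) -> loewner_le (mxpow B u) (mxpow A u) ->
  x != 0 -> mxpow B ((r + u) / 2) *m x = l%:C%C *: (mxpow A ((r + u) / 2) *m x) ->
  l <= 1.
Proof.
move=> posA posB BAr BAu x0 eigx; pose p := mxpow A ((u - r) / 2) *m x.
have Aux : 0 < rdot x (mxpow A u *m x) by apply: (mxpow_posdef u posA).2.
have pB : rdot p (mxpow B ((r + u) / 2) *m x) = l * rdot x (mxpow A u *m x).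
  rewrite eigx rdotZr rdot_mxpowD //; congr (_ * rdot _ (mxpow _ _ *m _)); lra.
have pA : rdot p (mxpow A r *m p) = rdot x (mxpow A u *m x).
  by rewrite !rdot_mxpow !mxpow_mulA //; congr (rdot _ (mxpow _ _ *m _)); lra.
have BpB : rdot (mxpow B (r / 2) *m p) (mxpow B (u / 2) *m x)
           = rdot p (mxpow B ((r + u) / 2) *m x).
  by rewrite rdot_mxpowD //; congr (rdot _ (mxpow _ _ *m _)); lra.
have sqrB z w : rdot (mxpow B (z / 2) *m w) (mxpow B (z / 2) *m w)
                = rdot w (mxpow B z *m w).
  by rewrite rdot_mxpowD //; congr (rdot _ (mxpow _ _ *m _)); lra.
have := rdot_ge0 (mxpow B (r / 2) *m p - mxpow B (u / 2) *m x).
rewrite !rdot_lin !sqrB (rdotC (mxpow B (u / 2) *m x)) BpB pB.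
have := BAr p; have := BAu x; rewrite pA => Bx Bp sq_ge0.
suff : l * rdot x (mxpow A u *m x) <= 1 * rdot x (mxpow A u *m x) by rewrite ler_pM2r.
by move: Bx Bp sq_ge0; rewrite mul1r; rdot_lra.
Qed.

Lemma mxpow_le_midpoint A B r u : posdef A -> posdef B ->
  loewner_le (mxpow B r) (mxpow A r) -> loewner_le (mxpow B u) (mxpow A u) ->
  loewner_le (mxpow B ((r + u) / 2)) (mxpow A ((r + u) / 2)).
Proof.
move=> posA posB BAr BAu; apply: loewner_le_generalized_eigenvalue.
- exact: mxpow_herm.
- exact: mxpow_posdef.
- by move=> l x; apply: mxpow_midpoint_eigenvalue_le1.
Qed.

Lemma continuity_Rpower_exponent (c : R) : continuity (Rpower c).
Proof. by rewrite /Rpower; reg. Qed.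

Lemma continuity_rdot_mxpow M v : posdef M ->
  continuity (fun r => rdot v (mxpow M r *m v)).
Proof.
move=> /posdefP [U [d [unitU _ ->]]].
apply: (continuity_eq
          (f := fun r => \sum_i Rpower (d i) r * normc2 ((U ^t* *m v) i 0))).
  by move=> r; rewrite mxpow_spec // rdot_spec_mx.
apply: continuity_sum => i _.
by apply: continuity_mult (continuity_Rpower_exponent _) _; apply: continuity_const.
Qed.

Theorem loewner_heinz A B r : posdef A -> posdef B -> loewner_le B A ->
  0 <= r <= 1 -> loewner_le (mxpow B r) (mxpow A r).
Proof.
move=> posA posB BA r01 v; rewrite -subr_ge0.
pose monotone_at x := loewner_le (mxpow B x) (mxpow A x).
apply: (@continuity_adherent_ge0
          (fun x => Rminus (rdot v (mxpow A x *m v)) (rdot v (mxpow B x *m v)))).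
  by apply: continuity_minus; apply: continuity_rdot_mxpow.
move=> e e0; have [||x y|y monoy yr] := @midpoint_dense monotone_at _ _ _ r e r01 e0.
- by rewrite /monotone_at !mxpow0.
- by rewrite /monotone_at !mxpow1.
- exact: mxpow_le_midpoint.
by exists y => //; rewrite RminusE subr_ge0; apply: monoy.
Qed.

End RealPowers.

(** * The equation for Lipschitz functions *)

Section HermitianPart.
Variables (R : rcfType) (n : nat).
Implicit Types (M N : 'M[R[i]]_n).

Definition hermpart M := (2^-1)%:C%C *: (M + M ^t*).

Lemma hermpart_herm M : (hermpart M) ^t* = hermpart M.
Proof. by rewrite trmxCZ trmxCD trmxCK addrC. Qed.

Lemma hermpart_id M : M ^t* = M -> hermpart M = M.
Proof.
move=> hermM; rewrite /hermpart hermM -mulr2n -scaler_nat scalerA.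
have -> : (2^-1)%:C%C * 2%:R = 1 :> R[i]; last exact: scale1r.
by rewrite -(rmorph_nat (real_complex R)) -rmorphM mulVf ?pnatr_eq0.
Qed.

Lemma fnorm_hermpartB M N : fnorm (hermpart M - hermpart N) <= fnorm (M - N).
Proof.
have -> : hermpart M - hermpart N = (2^-1)%:C%C *: ((M - N) + (M - N) ^t*).
  by rewrite -scalerBr trmxCB opprD addrACA.
rewrite fnormZ ger0_norm ?invr_ge0 //; have := fnormD (M - N) ((M - N) ^t*).
by rewrite fnorm_trmxC; lra.
Qed.

End HermitianPart.

Section SumOfConjugates.
Variables (R : rcfType) (m n : nat) (I : finType).
Variables (A : I -> 'M[R[i]]_(m, n)) (alpha : I -> R).
Hypothesis alpha_ge0 : forall i, 0 <= alpha i.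
Hypothesis normA : forall i, opnorm2_le (A i) (alpha i).
Implicit Types (M N : I -> 'M[R[i]]_m) (v : 'cV[R[i]]_n).

Definition conj_sum M : 'M[R[i]]_n := \sum_i (A i) ^t* *m M i *m A i.

Lemma eq_conj_sum M N : M =1 N -> conj_sum M = conj_sum N.
Proof. by move=> MN; apply: eq_bigr => i _; rewrite MN. Qed.

Lemma conj_sum_herm M : (forall i, (M i) ^t* = M i) -> (conj_sum M) ^t* = conj_sum M.
Proof.
move=> hermM; rewrite /conj_sum; elim/big_ind: _ => [|X Y hermX hermY|i _].
- by rewrite trmx0 map_mx0.
- by rewrite trmxCD hermX hermY.
- by rewrite !trmxC_mul trmxCK hermM mulmxA.
Qed.

Lemma rdot_conj_sum M v :
  rdot v (conj_sum M *m v) = \sum_i rdot (A i *m v) (M i *m (A i *m v)).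
Proof.
by rewrite mulmx_suml rdot_sumr; apply: eq_bigr => i _; rewrite rdot_conj.
Qed.

Lemma conj_sum_ge0 M :
  (forall i, loewner_le 0%:C%C%:M (M i)) -> loewner_le 0%:C%C%:M (conj_sum M).
Proof.
move=> M0; apply/loewner_scalarP => v; rewrite mul0r rdot_conj_sum.
by apply: sumr_ge0 => i _; have /loewner_scalarP/(_ (A i *m v)) := M0 i; rewrite mul0r.
Qed.

Lemma conj_sum_le M (c : I -> R) :
  (forall i, 0 <= c i) -> (forall i, loewner_le (M i) (c i)%:C%C%:M) ->
  loewner_le (conj_sum M) (\sum_i alpha i * c i)%:C%C%:M.
Proof.
move=> c0 Mc v; rewrite mul_scalar_mx rdotZr rdot_conj_sum mulr_suml.
apply: ler_sum => i _; apply: (le_trans (Mc i _)).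
by rewrite mul_scalar_mx rdotZr [alpha i * _]mulrC -mulrA ler_wpM2l //; apply: normA.
Qed.

Lemma fnorm_conj_sumB_le M N :
  fnorm (conj_sum M - conj_sum N) <= \sum_i alpha i * fnorm (M i - N i).
Proof.
rewrite -sumrB (le_trans (fnorm_sum _)) //; apply: ler_sum => i _.
by rewrite -mulmxBl -mulmxBr; apply: fnorm_conj_le.
Qed.

End SumOfConjugates.

Section FunctionalEquation.
Variables (n : nat) (I : finType) (A : I -> 'M[R[i]]_n) (Q : 'M[R[i]]_n).
Variables (alpha lip : I -> R) (f : I -> R -> R) (b : R).
Implicit Types (x y : R) (v : 'cV[R[i]]_n) (Y Z : 'M[R[i]]_n).
Hypothesis alpha_ge0 : forall i, 0 <= alpha i.
Hypothesis normA : forall i, opnorm2_le (A i) (alpha i).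
Hypothesis hermQ : Q ^t* = Q.
Hypothesis f_ge0 : forall i x, b <= x -> 0 <= f i x.
Hypothesis f_le : forall i x, b <= x -> f i x <= f i b.
Hypothesis f_lip : forall i x y, b <= x -> b <= y ->
  `|f i x - f i y| <= lip i * `|x - y|.
Hypothesis contraction : \sum_i alpha i * lip i < 1.
Hypothesis Q_ge : loewner_le (b + \sum_i alpha i * f i b)%:C%C%:M Q.

Let clamped i x := f i (Num.max b x).

Let b_le_max x : b <= Num.max b x.
Proof. by rewrite le_max lexx. Qed.

Let lip_ge0 i : 0 <= lip i.
Proof.
have b1 : b <= b + 1 by rewrite lerDl.
have := f_lip i (lexx b) b1; rewrite opprD addrA subrr add0r normrN normr1 mulr1.
exact: le_trans.
Qed.

Let clamped_lip i x y : `|clamped i x - clamped i y| <= lip i * `|x - y|.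
Proof.
apply: (le_trans (f_lip i (b_le_max x) (b_le_max y))); apply: ler_wpM2l => //.
rewrite ler_norml; have := ler_norm (x - y); have := ler_norm (y - x).
by rewrite (distrC y); case: (leP b x); case: (leP b y); lra.
Qed.

(* Clamping the argument of [f i] at [b] and passing to Hermitian parts makes the
   map a contraction of the whole matrix space, so that no invariant domain has to
   be exhibited; its fixed point is Hermitian and at least [b], where neither
   modification has any effect. *)
Let step Y := Q - conj_sum A (fun i => fcalc (clamped i) (hermpart Y)).

Let step_contraction Y Z :
  fnorm (step Y - step Z) <= (\sum_i alpha i * lip i) * fnorm (Y - Z).
Proof.
rewrite /step opprB addrC addrA subrK fnorm_distC.
apply: (le_trans (fnorm_conj_sumB_le alpha_ge0 normA _ _)).
rewrite mulr_suml; apply: ler_sum => i _; rewrite -mulrA ler_wpM2l //.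
have hermY := hermpart_herm Y; have hermZ := hermpart_herm Z.
rewrite (le_trans (fcalc_lipschitz hermY hermZ (lip_ge0 i) (clamped_lip i))) //.
by rewrite ler_wpM2l // fnorm_hermpartB.
Qed.

Theorem fcalc_equation_solution :
  exists Y, [/\ Y ^t* = Y, loewner_le b%:C%C%:M Y, loewner_le Y Q &
    Y + conj_sum A (fun i => fcalc (f i) Y) = Q].
Proof.
have k01 : 0 <= \sum_i alpha i * lip i < 1.
  by rewrite contraction andbT; apply: sumr_ge0 => i _; apply: mulr_ge0.
have [Y FY] := contraction_fixed_point k01 step_contraction.
have hermY : Y ^t* = Y.
  by rewrite -FY trmxCB hermQ conj_sum_herm // => i; apply: fcalc_herm.
rewrite /step hermpart_id // in FY; set S := conj_sum _ _ in FY.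
have S_ge0 : loewner_le 0%:C%C%:M S.
  apply: conj_sum_ge0 => i; rewrite -(fcalc_const 0 Y); apply: fcalc_le => x.
  exact: f_ge0.
have S_le : loewner_le S (\sum_i alpha i * f i b)%:C%C%:M.
  apply: conj_sum_le => // [i|i]; first exact: f_ge0.
  by rewrite -(fcalc_const _ Y); apply: fcalc_le => x; apply: f_le.
have rdotY v : rdot v (Y *m v) = rdot v (Q *m v) - rdot v (S *m v).
  by rewrite -rdotBr -mulmxBl FY.
have bY : loewner_le b%:C%C%:M Y.
  apply/loewner_scalarP => v; have := Q_ge v; have := S_le v.
  by rewrite rdotY !mul_scalar_mx !rdotZr mulrDl; rdot_lra.
exists Y; split=> // [v|].
  by have /loewner_scalarP/(_ v) := S_ge0; rewrite rdotY mul0r gerBl.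
have clampedE i : fcalc (clamped i) Y = fcalc (f i) Y.
  by apply: (eq_fcalc_ge hermY bY) => x bx; rewrite /clamped max_r.
by rewrite -(eq_conj_sum A clampedE) -/S -[X in X + _]FY subrK.
Qed.

End FunctionalEquation.

(** * The equation for negative powers *)

Section NegativePowers.
Implicit Types (a b k r x y : R).

Lemma Rpower_opp_le r x y : 0 <= r -> 0 < x -> x <= y ->
  Rpower y (- r) <= Rpower x (- r).
Proof.
move=> /RleP r0 /RltP x0 /RleP xy; apply/RleP; rewrite !Rpower_Ropp.
by apply: Rinv_le_contravar; [exact: exp_pos | exact: Rle_Rpower_l].
Qed.

Lemma derivable_pt_lim_Rpower_opp r x : 0 < x ->
  derivable_pt_lim (fun y => Rpower y (- r)) x (- r * Rpower x (- (r + 1))).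
Proof. by move=> /RltP x0; rewrite opprD; apply: derivable_pt_lim_power. Qed.

Lemma Rpower_opp_MVT r x y : 0 < x -> x < y -> exists c, [/\ x < c, c < y &
  Rpower x (- r) - Rpower y (- r) = r * Rpower c (- (r + 1)) * (y - x)].
Proof.
move=> x0 /RltP xy.
have derive c : Rle x c /\ Rle c y ->
    derivable_pt_lim (fun y => Rpower y (- r)) c (- r * Rpower c (- (r + 1))).
  by move=> [/RleP xc _]; apply/derivable_pt_lim_Rpower_opp/lt_le_trans/xc.
have [c [mvt [/RltP xc /RltP cy]]] := MVT_cor2 _ _ _ _ xy derive.
exists c; split=> //; rewrite !RminusE RmultE in mvt.
by rewrite -opprB mvt; ring.
Qed.

Lemma Rpower_opp_chord_le r a b x y : 0 <= r -> 0 < a -> a < b -> b <= x -> x <= y ->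
  (Rpower x (- r) - Rpower y (- r)) * (b - a)
    <= (Rpower a (- r) - Rpower b (- r)) * (y - x).
Proof.
move=> r0 a0 ab bx; rewrite le_eqVlt => /orP[/eqP <-|xy].
  by rewrite !subrr mul0r mulr0.
have x0 := lt_le_trans (lt_trans a0 ab) bx; have r1 : 0 <= r + 1 by rewrite addr_ge0.
have [c [ac cb ->]] := Rpower_opp_MVT r a0 ab.
have [c' [xc' _ ->]] := Rpower_opp_MVT r x0 xy.
have := Rpower_opp_le r1 (lt_trans a0 ac) (ltW (lt_trans cb (le_lt_trans bx xc'))).
move=> cc'; rewrite mulrAC ler_wpM2r ?subr_ge0 ?(ltW xy) //.
by rewrite ler_wpM2r ?subr_ge0 ?(ltW ab) // ler_wpM2l.
Qed.

Lemma Rpower_opp_chord_lipschitz r a b x y : 0 <= r -> 0 < a -> a < b ->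
  b <= x -> b <= y ->
  `|Rpower x (- r) - Rpower y (- r)|
    <= (Rpower a (- r) - Rpower b (- r)) / (b - a) * `|x - y|.
Proof.
move=> r0 a0 ab; wlog xy : x y / x <= y => [le_case bx yb|bx _].
  have [xy|/ltW yx] := leP x y; first exact: le_case.
  by rewrite distrC (distrC x); apply: le_case.
have x0 := lt_le_trans (lt_trans a0 ab) bx.
rewrite ger0_norm ?subr_ge0 ?Rpower_opp_le // distrC ger0_norm ?subr_ge0 //.
by rewrite mulrAC ler_pdivlMr ?subr_gt0 // Rpower_opp_chord_le.
Qed.

Lemma continuity_Rpower_exp r : continuity (fun z => Rpower (exp z) r).
Proof.
apply: (continuity_eq (f := fun z => exp (Rmult r z))); last by reg.
by move=> z; rewrite /Rpower ln_exp.
Qed.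

(* The substitution [b = exp z] makes the left-hand side continuous on the whole
   real line, as the intermediate value theorem requires. *)
Lemma Rpower_opp_sum_eq_exists (I : finType) (alpha r : I -> R) a k :
  (forall i, 0 <= alpha i) -> 0 < a ->
  a + \sum_i alpha i * Rpower a (- r i) < k ->
  exists2 b, a < b & b + \sum_i alpha i * Rpower b (- r i) = k.
Proof.
move=> alpha0 /[dup] a0 /RltP a0' ak.
have sum_ge0 y : 0 <= \sum_i alpha i * Rpower y (- r i).
  by apply: sumr_ge0 => i _; rewrite mulr_ge0 // ltW // Rpower_gt0.
have ak1 : a < k + 1 by have := sum_ge0 a; lra.
have /RltP k1 : 0 < k + 1 by lra.
pose h y := y + \sum_i alpha i * Rpower y (- r i) - k.
have cont_h : continuity (h \o exp).
  apply: continuity_minus; last exact: continuity_const.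
  apply: continuity_plus; first by reg.
  apply: continuity_sum => i _.
  exact: continuity_scal (continuity_Rpower_exp _).
have ha_lt0 : h a < 0 by rewrite subr_lt0.
have hk_gt0 : 0 < h (k + 1) by have := sum_ge0 (k + 1); rewrite /h; lra.
have [|||z [[/RleP az _] h_root]] := IVT (h \o exp) (ln a) (ln (k + 1)) cont_h.
- by apply: ln_increasing => //; apply/RltP.
- by rewrite /= exp_ln //; apply/RltP.
- by rewrite /= exp_ln //; apply/RltP.
exists (exp z); last by apply/eqP; rewrite -subr_eq0; apply/eqP.
have a_le : a <= exp z.
  rewrite -[a]exp_ln //; move: az; rewrite le_eqVlt => /orP[/eqP-> //|/RltP az].
  exact/ltW/RltP/exp_increasing.
have {}h_root : h (exp z) = 0 by exact: h_root.
rewrite lt_neqAle a_le andbT; apply/eqP => aE.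
by move: ha_lt0; rewrite aE h_root ltxx.
Qed.

End NegativePowers.

Section PowerEquation.
Variables (n : nat) (I : finType) (A : I -> 'M[R[i]]_n) (Q : 'M[R[i]]_n).
Variables (alpha : I -> R) (k a : R).
Implicit Types (r t : I -> R) (s : R).
Hypothesis alpha_ge0 : forall i, 0 <= alpha i.
Hypothesis normA : forall i, opnorm2_le (A i) (alpha i).
Hypothesis Q_ge : loewner_le k%:C%C%:M Q.
Hypothesis a_gt0 : 0 < a.

(* With [b + \sum_i alpha i * b^(-r i) = k], the negative powers have on [b, oo) the
   slopes of their chords over [a, b] as Lipschitz constants, and the strict
   inequality at [a] says exactly that these add up to less than [1]. *)
Lemma power_equation_solution r : Q ^t* = Q -> (forall i, 0 <= r i) ->
  a + \sum_i alpha i * Rpower a (- r i) < k ->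
  exists Y, [/\ Y ^t* = Y, loewner_le a%:C%C%:M Y, loewner_le Y Q &
    Y + conj_sum A (fun i => mxpow Y (- r i)) = Q].
Proof.
move=> hermQ r0 ak; have [b ab bE] := Rpower_opp_sum_eq_exists alpha_ge0 a_gt0 ak.
have b0 := lt_trans a_gt0 ab; have ba0 : 0 < b - a by rewrite subr_gt0.
pose lip i := (Rpower a (- r i) - Rpower b (- r i)) / (b - a).
have lip1 : \sum_i alpha i * lip i < 1.
  under eq_bigr => i _ do rewrite /lip mulrA mulrBr.
  by rewrite -mulr_suml sumrB ltr_pdivrMr //; lra.
have pow_ge0 i x : b <= x -> 0 <= Rpower x (- r i) by move=> _; apply/ltW/Rpower_gt0.
have pow_le i x : b <= x -> Rpower x (- r i) <= Rpower b (- r i).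
  exact: Rpower_opp_le.
have pow_lip i x y : b <= x -> b <= y ->
    `|Rpower x (- r i) - Rpower y (- r i)| <= lip i * `|x - y|.
  exact: Rpower_opp_chord_lipschitz.
have Qb : loewner_le (b + \sum_i alpha i * Rpower b (- r i))%:C%C%:M Q by rewrite bE.
have [Y [hermY bY YQ EY]] :=
  fcalc_equation_solution alpha_ge0 normA hermQ pow_ge0 pow_le pow_lip lip1 Qb.
exists Y; split; [exact: hermY | | exact: YQ |].
  apply/loewner_scalarP => v; have /loewner_scalarP/(_ v) := bY; apply: le_trans.
  by rewrite ler_wpM2r ?rdot_ge0 // ltW.
by rewrite -[RHS]EY; congr (_ + _); apply: eq_conj_sum => i; rewrite mxpow.unlock.
Qed.

Lemma power_equation_root_solution s t : 1 <= s -> (forall i, 0 <= t i) ->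
  posdef Q -> a + \sum_i alpha i * Rpower a (- (t i / s)) < k ->
  exists X, [/\ posdef X, mxpow X s + conj_sum A (fun i => mxpow X (- t i)) = Q,
    loewner_le (Rpower a s^-1)%:C%C%:M X & loewner_le X (mxpow Q s^-1)].
Proof.
move=> s1 t0 posQ ak; have s0 : 0 < s := lt_le_trans ltr01 s1.
have sV0 : 0 <= s^-1 by rewrite invr_ge0 ltW.
have [i|Y [hermY aY YQ EY]] := power_equation_solution (posdef_herm posQ) _ ak.
  by rewrite divr_ge0 // ltW.
have posY := loewner_ge_posdef a_gt0 hermY aY.
have Ys : mxpow (mxpow Y s^-1) s = Y by rewrite mxpowM // mulVf ?gt_eqF // mxpow1.
have Yt i : mxpow (mxpow Y s^-1) (- t i) = mxpow Y (- (t i / s)).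
  by rewrite mxpowM // mulrN mulrC.
exists (mxpow Y s^-1); split.
- exact: mxpow_posdef.
- by rewrite Ys (eq_conj_sum A Yt).
- exact: mxpow_ge.
- by apply: loewner_heinz; rewrite // sV0 invf_le1.
Qed.

End PowerEquation.

Section NormThreshold.
Implicit Types (a k kt q qt r u x y : R).

Lemma Rpower_opp_le_exponent a r u : 0 < a -> a <= 1 -> r <= u ->
  Rpower a (- r) <= Rpower a (- u).
Proof.
move=> a0 a1 ru; have -> : - u = - r + - (u - r) by ring.
rewrite Rpower_plus RmultE ler_pMr ?Rpower_gt0 //.
have pow1 : Rpower 1 (- (u - r)) = 1 by rewrite /Rpower ln_1 Rmult_0_r exp_0.
by rewrite -[leLHS]pow1 Rpower_opp_le ?subr_ge0.
Qed.

Lemma norm_thresholdE q qt kt k : 0 < q -> 0 < kt -> 0 < k ->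
  Rpower q qt * Rpower kt (qt + 1) / (Rpower k qt * Rpower (q + 1) (qt + 1))
    = Rpower (q * kt / (k * (q + 1))) qt * (kt / (q + 1)).
Proof.
move=> q0 kt0 k0; have q10 : 0 < q + 1 by rewrite addr_gt0.
have kq0 : 0 < k * (q + 1) by rewrite mulr_gt0.
have powM x y : 0 < x -> 0 < y -> Rpower (x * y) qt = Rpower x qt * Rpower y qt.
  by move=> /RltP x0 /RltP y0; apply/esym/Rpower_mult_distr.
have powD1 x : 0 < x -> Rpower x (qt + 1) = Rpower x qt * x.
  by move=> /RltP x0; rewrite Rpower_plus Rpower_1.
set a := q * kt / _; have a0 : 0 < a by rewrite divr_gt0 ?mulr_gt0.
have powE : Rpower q qt * Rpower kt qt
    = Rpower a qt * (Rpower k qt * Rpower (q + 1) qt).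
  by rewrite -!powM // divfK // gt_eqF.
rewrite !powD1 // mulrA powE; field.
by rewrite !gt_eqF ?Rpower_gt0.
Qed.

Lemma sum_Rpower_opp_lt (I : finType) (alpha r : I -> R) q qt kt k :
  0 < q -> 0 < kt -> kt <= k -> 1 < k ->
  (forall i, 0 <= alpha i) -> (forall i, r i <= qt) ->
  let a := q * kt / (k * (q + 1)) in
  \sum_i alpha i <
    Rpower q qt * Rpower kt (qt + 1) / (Rpower k qt * Rpower (q + 1) (qt + 1)) ->
  a + \sum_i alpha i * Rpower a (- r i) < kt.
Proof.
move=> q0 kt0 ktk k1 alpha0 rqt a; have k0 : 0 < k := lt_trans ltr01 k1.
rewrite norm_thresholdE // -/a => alpha_lt.
have q10 : 0 < q + 1 by rewrite addr_gt0.
have kq0 : 0 < k * (q + 1) by rewrite mulr_gt0.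
have a0 : 0 < a by rewrite divr_gt0 ?mulr_gt0.
have a1 : a <= 1.
  by rewrite ler_pdivrMr // mul1r; have := ler_wpM2l (ltW q0) ktk; lra.
have sum_lt : \sum_i alpha i * Rpower a (- r i) < kt / (q + 1).
  apply: (@le_lt_trans _ _ ((\sum_i alpha i) * Rpower a (- qt))).
    rewrite mulr_suml; apply: ler_sum => i _.
    by rewrite ler_wpM2l // Rpower_opp_le_exponent.
  by rewrite Rpower_Ropp RinvE ltr_pdivrMr ?Rpower_gt0 // mulrC.
have ktE : a * k + kt / (q + 1) = kt by rewrite /a; field; rewrite !gt_eqF.
by rewrite -[ltRHS]ktE; apply: ltrD sum_lt; rewrite ltr_pMr.
Qed.

End NormThreshold.

Lemma two_term_power_equation_solution (n : nat) (A B Q : 'M[R[i]]_n)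
    (s t p alpha beta k kt : R) :
  1 <= s -> 1 <= t -> 1 <= p -> 0 <= alpha -> 0 <= beta ->
  opnorm2_le A alpha -> opnorm2_le B beta ->
  posdef Q -> 0 < kt -> kt <= k -> 1 < k -> loewner_le kt%:C%C%:M Q ->
  let q := Num.min (t / s) (p / s) in
  let qt := Num.max (t / s) (p / s) in
  alpha + beta <
    Rpower q qt * Rpower kt (qt + 1) / (Rpower k qt * Rpower (q + 1) (qt + 1)) ->
  exists X, [/\ posdef X,
    mxpow X s + (A ^t* *m mxpow X (- t) *m A + B ^t* *m mxpow X (- p) *m B) = Q,
    loewner_le (Rpower (q * kt / (k * (q + 1))) s^-1)%:C%C%:M X &
    loewner_le X (mxpow Q s^-1)].
Proof.
move=> s1 t1 p1 alpha0 beta0 normA normB posQ kt0 ktk k1 ktQ q qt small.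
have ge1_gt0 x : 1 <= x -> 0 < x :> R by apply: lt_le_trans.
have q0 : 0 < q by rewrite lt_min !divr_gt0 ?ge1_gt0.
pose coef (c : bool) := if c then alpha else beta.
pose expo (c : bool) := if c then t else p.
pose mx (c : bool) := if c then A else B.
have coef_ge0 c : 0 <= coef c by case: c.
have mx_le c : opnorm2_le (mx c) (coef c) by case: c.
have expo_ge0 c : 0 <= expo c by case: c; rewrite ltW // ge1_gt0.
have expo_le c : expo c / s <= qt by case: c; rewrite le_max lexx ?orbT.
have := @sum_Rpower_opp_lt _ coef (fun c => expo c / s) q qt kt k q0 kt0 ktk k1
  coef_ge0 expo_le; rewrite big_bool => /(_ small); set a := q * kt / _ => a_lt.
have a0 : 0 < a by rewrite divr_gt0 ?mulr_gt0 ?addr_gt0 // (lt_trans ltr01).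
have [X [posX EX aX XQ]] := power_equation_root_solution coef_ge0 mx_le ktQ a0 s1
  expo_ge0 posQ a_lt.
by exists X; split=> //; rewrite -[RHS]EX /conj_sum big_bool.
Qed.

(** * Matrices indexed by natural numbers *)

Section Translation.
Variable n : nat.
Implicit Types (A B M N X : Mat) (v w : Vec).

Definition C_to_complex (z : Defs.C) : R[i] := (re z +i* im z)%C.
Definition complex_to_C (z : R[i]) : Defs.C := mkC (complex.Re z) (complex.Im z).
Definition Mat_to_mx A : 'M[R[i]]_n := \matrix_(i, j) C_to_complex (A i j).
Definition Vec_to_cV v : 'cV[R[i]]_n := \col_i C_to_complex (v i).
Definition cV_to_Vec (v : 'cV[R[i]]_n) : Vec :=
  fun i => if insub i is Some i' then complex_to_C (v i' 0) else C0.
Definition mx_to_Mat (M : 'M[R[i]]_n) : Mat :=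
  fun i j => if insub j is Some j' then cV_to_Vec (col j' M) i else C0.

Lemma complex_to_CK : cancel complex_to_C C_to_complex.
Proof. by case. Qed.

Lemma C_to_complex_inj : injective C_to_complex.
Proof. by case=> a b [c d] [-> ->]. Qed.

Lemma C_to_complexD z t : C_to_complex (Cadd z t) = C_to_complex z + C_to_complex t.
Proof. by []. Qed.

Lemma C_to_complexM z t : C_to_complex (Cmul z t) = C_to_complex z * C_to_complex t.
Proof. by []. Qed.

Lemma C_to_complex_conj z : C_to_complex (Cconj z) = (C_to_complex z)^*.
Proof. by []. Qed.

Lemma C_to_complex_csum f m :
  C_to_complex (csum f m) = \sum_(i < m) C_to_complex (f i).
Proof.
elim: m => [|m IH] /=; first by rewrite big_ord0.
by rewrite big_ord_recr /= C_to_complexD IH.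
Qed.

Lemma cV_to_VecK : cancel cV_to_Vec Vec_to_cV.
Proof. by move=> v; apply/colP => i; rewrite mxE /cV_to_Vec valK complex_to_CK. Qed.

Lemma mx_to_MatK : cancel mx_to_Mat Mat_to_mx.
Proof.
move=> M; apply/matrixP => i j.
by rewrite mxE /mx_to_Mat valK /cV_to_Vec valK complex_to_CK mxE.
Qed.

Lemma meqP A B : meq n A B <-> Mat_to_mx A = Mat_to_mx B.
Proof.
split=> [AB|/matrixP AB i j /ssrnat.ltP hi /ssrnat.ltP hj].
  by apply/matrixP => i j; rewrite !mxE AB //; apply/ssrnat.ltP.
by have := AB (Ordinal hi) (Ordinal hj); rewrite !mxE => /C_to_complex_inj.
Qed.

Lemma veqP v w : veq n v w <-> Vec_to_cV v = Vec_to_cV w.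
Proof.
split=> [vw|/colP vw i /ssrnat.ltP hi].
  by apply/colP => i; rewrite !mxE vw //; apply/ssrnat.ltP.
by have := vw (Ordinal hi); rewrite !mxE => /C_to_complex_inj.
Qed.

Lemma Mat_to_mxM A B : Mat_to_mx (mmul n A B) = Mat_to_mx A *m Mat_to_mx B.
Proof.
apply/matrixP => i j; rewrite !mxE C_to_complex_csum.
by apply: eq_bigr => l _; rewrite !mxE C_to_complexM.
Qed.

Lemma Mat_to_mxD A B : Mat_to_mx (madd A B) = Mat_to_mx A + Mat_to_mx B.
Proof. by apply/matrixP => i j; rewrite !mxE C_to_complexD. Qed.

Lemma Mat_to_mxB A B : Mat_to_mx (msub A B) = Mat_to_mx A - Mat_to_mx B.
Proof.
apply/matrixP => i j; rewrite !mxE C_to_complexD C_to_complexM -mulN1r.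
by congr (_ + _ * _); apply/eqP; rewrite eq_complex /= oppr0 !eqxx.
Qed.

Lemma Mat_to_mx_adj A : Mat_to_mx (madj A) = (Mat_to_mx A) ^t*.
Proof. by apply/matrixP => i j; rewrite !mxE C_to_complex_conj. Qed.

Lemma Mat_to_mx_diag (d : nat -> R) :
  Mat_to_mx (mdiag d) = diag_mx (\row_i (d (nat_of_ord i))%:C%C).
Proof.
apply/matrixP => i j; rewrite !mxE /mdiag.
have -> : Nat.eqb i j = (i == j) by apply/PeanoNat.Nat.eqb_spec/eqP => [/val_inj|->].
by case: eqP => // _; rewrite mulr1n.
Qed.

Lemma Mat_to_mx_scal (c : R) : Mat_to_mx (mscal c) = c%:C%C%:M.
Proof.
rewrite -diag_const_mx -[mscal c]/(mdiag (fun=> c)) Mat_to_mx_diag; congr diag_mx.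
by apply/rowP => i; rewrite !mxE.
Qed.

Lemma Vec_to_cV_mul A v : Vec_to_cV (mvmul n A v) = Mat_to_mx A *m Vec_to_cV v.
Proof.
apply/colP => i; rewrite !mxE C_to_complex_csum.
by apply: eq_bigr => l _; rewrite !mxE C_to_complexM.
Qed.

Lemma re_innerE v w : re (inner n v w) = rdot (Vec_to_cV v) (Vec_to_cV w).
Proof.
rewrite rdot.unlock -[LHS]/(complex.Re (C_to_complex (inner n v w))).
rewrite C_to_complex_csum /mxtrace big_ord1 mxE.
congr complex.Re; apply: eq_bigr => i _.
by rewrite !mxE C_to_complexM C_to_complex_conj.
Qed.

Lemma vnonzeroP v : vnonzero n v <-> Vec_to_cV v != 0.
Proof.
split=> [[i [/ssrnat.ltP hi vi]]|/matrix0Pn [i [j]]].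
  apply/eqP => /colP /(_ (Ordinal hi)); rewrite !mxE => v0.
  by apply: vi; apply: C_to_complex_inj; rewrite v0.
rewrite mxE => vi; exists i; split; first exact/ssrnat.ltP.
by move=> v0; rewrite v0 eqxx in vi.
Qed.

Lemma HermitianP M : Defs.Hermitian n M <-> (Mat_to_mx M) ^t* = Mat_to_mx M.
Proof. by rewrite -Mat_to_mx_adj; apply: meqP. Qed.

Lemma PDP M : PD n M <-> posdef (Mat_to_mx M).
Proof.
split=> [[/HermitianP hermM pos]|[/HermitianP hermM pos]]; split=> // v.
  move=> v0; have /pos/RltP : vnonzero n (cV_to_Vec v).
    by apply/vnonzeroP; rewrite cV_to_VecK.
  by rewrite re_innerE Vec_to_cV_mul cV_to_VecK.
by move=> /vnonzeroP v0; apply/RltP; rewrite re_innerE Vec_to_cV_mul; apply: pos.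
Qed.

Lemma loewner_le_Lle M N : Defs.Hermitian n M -> Defs.Hermitian n N ->
  loewner_le (Mat_to_mx M) (Mat_to_mx N) -> Lle n M N.
Proof.
move=> /HermitianP hermM /HermitianP hermN MN; split.
  by apply/HermitianP; rewrite Mat_to_mxB trmxCB hermM hermN.
move=> v; apply/RleP; rewrite re_innerE Vec_to_cV_mul Mat_to_mxB mulmxBl rdotBr.
by rewrite subr_ge0; apply: MN.
Qed.

Lemma mscal_Hermitian (c : R) : Defs.Hermitian n (mscal c).
Proof.
apply/HermitianP; rewrite Mat_to_mx_scal tr_scalar_mx map_scalar_mx.
by congr (_%:M); apply: conjc_real.
Qed.

Lemma Mat_to_mx_spec U (d : nat -> R) :
  Mat_to_mx (mmul n (mmul n U (mdiag d)) (madj U))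
  = spec_mx (Mat_to_mx U) (fun i => d (nat_of_ord i)).
Proof.
by rewrite spec_mx.unlock /udiag_mx !Mat_to_mxM Mat_to_mx_adj Mat_to_mx_diag.
Qed.

Lemma UnitaryP U : Unitary n U <-> Mat_to_mx U \is unitarymx.
Proof.
rewrite /Unitary meqP Mat_to_mxM Mat_to_mx_adj Mat_to_mx_scal -trmxC_unitary.
by split=> [UU|/unitarymxP]; [apply/unitarymxP|]; rewrite trmxCK.
Qed.

Lemma PowRel_mxpow X r M : PowRel n X r M -> Mat_to_mx M = mxpow (Mat_to_mx X) r.
Proof.
move=> [U [d [/UnitaryP unitU [_ [/meqP XE /meqP ME]]]]].
by rewrite ME XE !Mat_to_mx_spec mxpow_spec.
Qed.

Lemma PowRel_exists X r : posdef (Mat_to_mx X) -> exists M, PowRel n X r M.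
Proof.
move=> /posdefP [U [d [unitU d0 XE]]]; exists (mx_to_Mat (mxpow (Mat_to_mx X) r)).
pose d' i := if insub i is Some i' then d i' else 0.
have dE : (fun i => d' (nat_of_ord i)) =1 d by move=> i; rewrite /d' valK.
exists (mx_to_Mat U), d'; split; [|split; [|split]].
- by apply/UnitaryP; rewrite mx_to_MatK.
- by move=> i /ssrnat.ltP hi; rewrite /d' insubT; apply/RltP; apply: d0.
- by apply/meqP; rewrite Mat_to_mx_spec mx_to_MatK XE (eq_spec_mx _ dE).
- apply/meqP; rewrite Mat_to_mx_spec !mx_to_MatK XE mxpow_spec //.
  by apply: eq_spec_mx => i; rewrite dE.
Qed.

Lemma Mat_to_mx_mpow X r :
  posdef (Mat_to_mx X) -> Mat_to_mx (mpow n X r) = mxpow (Mat_to_mx X) r.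
Proof.
by move=> posX; apply: PowRel_mxpow; apply: epsilon_spec; apply: PowRel_exists.
Qed.

Lemma mpow_Hermitian X r : posdef (Mat_to_mx X) -> Defs.Hermitian n (mpow n X r).
Proof. by move=> posX; apply/HermitianP; rewrite Mat_to_mx_mpow // mxpow_herm. Qed.

Lemma eigvalP M (mu : R) : eigval n M mu <->
  exists2 v : 'cV_n, v != 0 & Mat_to_mx M *m v = mu%:C%C *: v.
Proof.
have scaleE v : Vec_to_cV (fun i => Cmul (RtoC mu) (v i)) = mu%:C%C *: Vec_to_cV v.
  by apply/colP => i; rewrite !mxE C_to_complexM.
split=> [[v [/vnonzeroP v0 /veqP E]]|[v v0 E]].
  by exists (Vec_to_cV v) => //; rewrite -Vec_to_cV_mul E scaleE.
exists (cV_to_Vec v); split; first by apply/vnonzeroP; rewrite cV_to_VecK.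
by apply/veqP; rewrite Vec_to_cV_mul scaleE cV_to_VecK.
Qed.

Lemma is_lmin_gt0 M (mu : R) : posdef (Mat_to_mx M) -> is_lmin n M mu -> 0 < mu.
Proof.
move=> [_ pos] [/eigvalP [v v0 vE] _]; have := pos v v0.
by rewrite vE rdotZr pmulr_lgt0 // rdot_gt0.
Qed.

Lemma is_lmin_loewner M (mu : R) : Defs.Hermitian n M -> is_lmin n M mu ->
  loewner_le mu%:C%C%:M (Mat_to_mx M).
Proof.
move=> /HermitianP /spec_mxP [U [d [unitU ME]]] [_ min_mu].
rewrite ME -(spec_mx_const _ unitU); apply: spec_mx_le => i; apply/RleP/min_mu/eigvalP.
by exists (col i U); [exact: col_unitary_neq0 | rewrite ME spec_mx_col].
Qed.

Lemma is_opnorm_opnorm2_le M (a : R) :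
  is_opnorm n M a -> opnorm2_le (Mat_to_mx M) (a ^+ 2).
Proof.
move=> [ub _] v; have [->|v0] := eqVneq v 0; first by rewrite mulmx0 rdot0r mulr0.
have norm0 : 0 < fnorm v by rewrite lt0r fnorm_ge0 fnorm_eq0 v0.
pose w := (fnorm v)^-1%:C%C *: v.
have vE : v = (fnorm v)%:C%C *: w.
  by rewrite scalerA -rmorphM mulfV ?gt_eqF // scale1r.
have fnormw : fnorm w = 1 by rewrite fnormZ gtr0_norm ?invr_gt0 // mulVf ?gt_eqF.
have Mw : fnorm (Mat_to_mx M *m w) <= a.
  apply/RleP; apply: ub; exists (cV_to_Vec w).
  rewrite /vnorm2 !re_innerE Vec_to_cV_mul cV_to_VecK RsqrtE; split=> //.
  by rewrite -sqr_fnorm fnormw expr1n.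
rewrite {1 2}vE -scalemxAr rdotZl rdotZr mulrA -expr2 sqr_fnorm mulrC.
rewrite ler_wpM2r ?rdot_ge0 //.
by rewrite -fnorm_le_sqr // (le_trans (fnorm_ge0 _) Mw).
Qed.

End Translation.

Close Scope sesquilinear_scope.
Close Scope ring_scope.
#[local] Bind Scope R_scope with R.
#[local] Arguments Rpower (_ _)%_R_scope.
Local Open Scope R_scope.

Theorem mainTheorem5 (n : nat) (s t p : R) (A B Q : Mat) (k kt nA nB : R) :
  1 <= s -> 1 <= t -> 1 <= p ->
  GL n A -> GL n B -> PD n Q ->
  is_lmax n Q k -> 1 < k -> is_lmin n Q kt ->
  is_opnorm n A nA -> is_opnorm n B nB ->
  let q := Rmin (t / s) (p / s) in
  let qt := Rmax (t / s) (p / s) in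
  nA ^ 2 + nB ^ 2 <
    Rpower q qt * Rpower kt (qt + 1) / (Rpower k qt * Rpower (q + 1) (qt + 1)) ->
  exists X, PD n X /\
    meq n (madd (mpow n X s)
              (madd (mmul n (mmul n (madj A) (mpow n X (- t))) A)
                    (mmul n (mmul n (madj B) (mpow n X (- p))) B))) Q /\
    Lle n (mscal (Rpower (q * kt / (k * (q + 1))) (1 / s))) X /\
    Lle n X (mpow n Q (1 / s)).
Proof.
move=> /RleP s1 /RleP t1 /RleP p1 _ _ /PDP posQ [eigk _] /RltP k1 minQ normA normB.
rewrite !RminE !RmaxE !RpowE => q qt /RltP small.
have /RleP ktk : kt <= k by apply: (proj2 minQ).
have [hermQ _] := (PDP n Q).2 posQ.
have [X [posX EX aX XQ]] := two_term_power_equation_solution s1 t1 p1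
  (sqr_ge0 nA) (sqr_ge0 nB) (is_opnorm_opnorm2_le normA) (is_opnorm_opnorm2_le normB)
  posQ (is_lmin_gt0 posQ minQ) ktk k1 (is_lmin_loewner hermQ minQ) small.
rewrite -(mx_to_MatK X) in posX EX aX XQ; have /PDP PDX := posX.
have hermX := proj1 PDX; rewrite !RdivE !div1r.
exists (mx_to_Mat X); split; [exact: PDX | split; [|split]].
- by apply/meqP; rewrite !Mat_to_mxD !Mat_to_mxM !Mat_to_mx_adj !Mat_to_mx_mpow.
- apply: loewner_le_Lle; [exact: mscal_Hermitian | exact: hermX |].
  by rewrite Mat_to_mx_scal.
- apply: loewner_le_Lle; [exact: hermX | exact: mpow_Hermitian |].
  by rewrite Mat_to_mx_mpow.
Qed.
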